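(* Suppose $X$ is a metric continuum and $f:X\to 2^X$ is an idempotent surjective upper semi-continuous function whose graph is connected and is the union of (the graphs of) a collection of upper semi-continuous functions, each of which has domain $X$ and maps into $C(X)$. Let $\{X,f,D\}$ be the inverse limit system with the single idempotent bonding function $f$ and a totally ordered index set $D$. Then the inverse limit $\varprojlim\mathbf{f}$ of the system $\{X,f,D\}$ is a Hausdorff continuum.
   Context: A Hausdorff continuum is a non-empty, compact and connected subset of a Hausdorff space; a metric continuum is a metrizable Hausdorff continuum. For a non-empty compact Hausdorff space $X$, $2^X$ denotes the set of non-empty compact subsets of $X$ and $C(X)$ the set of connected members of $2^X$. A function $f:X\to 2^X$ is upper semi-continuous (u.s.c.) if for all $x\in X$ and every open $V\subseteq X$ containing $f(x)$ there is an open $U\subseteq X$ containing $x$ with $f(u)\subseteq V$ for each $u\in U$ (equivalently, its graph $\{(x,y)\in X\times X\mid y\in f(x)\}$ is closed). $f$ is surjective if for every $y\in X$ there is $x\in X$ with $y\in f(x)$. $f$ is idempotent if $f\circ f=f$, where $(f\circ f)(x)=\{z\in X\mid\exists y\in X\text{ with }y\in f(x)\text{ and }z\in f(y)\}$. A totally ordered index set is a set $D$ with a reflexive, transitive, antisymmetric and total relation $\preceq$; $\alpha\prec\beta$ means $\alpha\preceq\beta$ and $\alpha\neq\beta$. The system $\{X,f,D\}$ with the single idempotent bonding function $f$ has all factor spaces $X_\alpha=X$ ($\alpha\in D$), bonding functions $f_{\alpha\beta}=f$ for $\alpha\prec\beta$ in $D$, and $f_{\alpha\alpha}$ the identity on $X$.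 Its inverse limit is $\varprojlim\mathbf{f}=\{\mathbf{x}\in\prod_{\alpha\in D}X\mid x_\alpha\in f_{\alpha\beta}(x_\beta)\ \forall\,\alpha\preceq\beta\in D\}$, with the subspace topology from the product topology. *)

(* Defs.v *)
From HB Require Import structures.
From mathcomp Require Import all_boot all_order all_algebra.
From mathcomp Require Import all_classical all_reals all_analysis.

Set Implicit Arguments.
Unset Strict Implicit.
Unset Printing Implicit Defensive.

Local Open Scope classical_set_scope.

Definition hausdorff_continuum (T : topologicalType) (A : set T) : Prop :=
  [/\ hausdorff_space T, A !=set0, compact A & connected A].

(* A metric continuum is presented by a compatible metric. *)
Definition metric_continuum (R : realType) (X : metricType R) : Prop :=
  hausdorff_continuum [set: X].

(* 2^X and C(X).  A function X -> 2^X is represented by f : X -> set X with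
   forall x, hyperspace (f x); thus f x y means y \in f(x). *)
Definition hyperspace (X : topologicalType) : set (set X) :=
  [set A | A !=set0 /\ compact A].

Definition subcontinua (X : topologicalType) : set (set X) :=
  [set A | hyperspace A /\ connected A].

Definition usc (X Y : topologicalType) (f : X -> set Y) : Prop :=
  forall (x : X) (V : set Y), open V -> f x `<=` V ->
    exists U : set X, [/\ open U, U x & forall u, U u -> f u `<=` V].

Definition graph (X Y : Type) (f : X -> set Y) : set (X * Y) :=
  [set p | f p.1 p.2].

Definition mv_surjective (X Y : Type) (f : X -> set Y) : Prop :=
  forall y : Y, exists x : X, f x y.

Definition mv_comp (X Y Z : Type) (g : Y -> set Z) (f : X -> set Y) :
  X -> set Z :=
  fun x => [set z | exists y, f x y /\ g y z].

Definition mv_idempotent (X : Type) (f : X -> set X) : Prop :=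
  mv_comp f f = f.

(* The bonding function f a b goes from the factor at b to the factor at a and
   is only used for a <= b. *)
Definition inverse_limit (disp : Order.disp_t) (D : orderType disp)
    (X : D -> topologicalType) (f : forall a b : D, X b -> set (X a)) :
    set (prod_topology X) :=
  [set x | forall a b : D, (a <= b)%O -> f a b (x b) (x a)].

(* f_ab = f for a < b and f_aa = id; the value for b < a is irrelevant. *)
Definition single_bonding (disp : Order.disp_t) (D : orderType disp)
    (X : Type) (f : X -> set X) (a b : D) : X -> set X :=
  if (a < b)%O then f else fun x => [set x].

Definition single_inverse_limit (disp : Order.disp_t) (D : orderType disp)
    (X : topologicalType) (f : X -> set X) :
    set (prod_topology (fun _ : D => X)) :=
  @inverse_limit disp D (fun _ : D => X) (single_bonding f).

(* Main.v *)
(** For a finite subset [s] of [D], let [partial_limit f s] be the points of the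
    full product satisfying the bonding conditions between coordinates in [s].
    Put a new least index [a] in front of the minimum [b] of [s]; by idempotency
    only the condition [x a \in f (x b)] has to be added.  If [f] is replaced by
    a member [g] of the family, the new set is mapped onto [partial_limit f s]
    by forgetting coordinate [a], with connected fibers [g (x b)], hence is
    connected.  For [f] itself, a separation of the new set would yield two
    closed sets covering the graph of [f] under [x |-> (x b, x a)]; they share a
    point [(p, t)] since the graph is connected, and if [t \in g p] then the
    connected set built from [g] meets both sides of the separation.  The
    inverse limit is the intersection of the directed family of all
    [partial_limit f s], so it is nonempty and connected by compactness. *)

Require Import Defs.
From mathcomp Require Import all_boot all_order all_algebra.
From mathcomp Require Import all_classical all_reals all_analysis.

Import Order.TTheory.

Local Open Scope classical_set_scope.

(** * Connectedness through closed covers *)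

(** If [A] missed the intersection of [B] and [C], its part in [B] would also be its part outside
    [C], hence clopen in [A], hence all of [A]. *)
Lemma connected_closed_meet {T : topologicalType} {A B C : set T} :
  connected A -> closed B -> closed C -> A `<=` B `|` C ->
  A `&` B !=set0 -> A `&` C !=set0 -> A `&` (B `&` C) !=set0.
Proof.
move=> Aconn Bcl Ccl ABC AB0 [c [Ac Cc]]; apply/set0P/negP => /eqP ABC0.
suff AB : A `&` B = A.
  have [_ Bc] : (A `&` B) c by rewrite AB.
  by have : (A `&` (B `&` C)) c by []; rewrite ABC0.
apply: Aconn => //; last by exists B.
exists (~` C); first exact: closed_openC.
apply/seteqP; split=> x [Ax H]; split=> //.
  by move=> Cx; have : (A `&` (B `&` C)) x by []; rewrite ABC0.
by have [|/H] := ABC x Ax.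
Qed.

(** If a nonempty [B] is clopen in [A], cut out by an open [U], the complement of [U] cuts out a
    disjoint closed remainder, which must then be empty. *)
Lemma closed_connected {T : topologicalType} {A : set T} : closed A ->
  (forall B C, closed B -> closed C -> A = B `|` C ->
    B !=set0 -> C !=set0 -> B `&` C !=set0) ->
  connected A.
Proof.
move=> Acl H B B0 [U oU BU] [F Fcl BF].
have AU0 : A `&` ~` U = set0.
  apply/eqP/negPn/negP => /set0P AU0.
  have [||||//|x [+ [_ nUx]]] := H B (A `&` ~` U) => //.
  - by rewrite BF; apply: closedI.
  - by apply: closedI => //; apply: open_closedC.
  - by rewrite BU -setIUr setUCr setIT.
  - by rewrite BU => -[].
by move/disjoints_subset : AU0; rewrite setCK BU => AU; apply/setIidl.
Qed.

Lemma image_closed {S T : topologicalType} {p : T -> S} {A B : set T} :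
  hausdorff_space S -> continuous p -> compact A -> closed B -> B `<=` A ->
  closed (p @` B).
Proof.
move=> hS pc Ac Bcl BA; apply: compact_closed => //.
apply: continuous_compact; first exact: continuous_subspaceT.
exact: subclosed_compact BA.
Qed.

(** The images of two nonempty closed pieces covering [A] are closed by compactness and share a
    point of the connected image; a fiber over it meets both pieces, hence their intersection. *)
Lemma connected_fibers {S T : topologicalType} {p : T -> S} {A : set T} :
  hausdorff_space S -> hausdorff_space T -> continuous p -> compact A ->
  connected (p @` A) ->
  (forall x, A x -> connected (A `&` p @^-1` [set p x])) ->
  connected A.
Proof.
move=> hS hT pc Ac pAconn fib.
apply: closed_connected; first exact: compact_closed.
move=> B C Bcl Ccl ABC [b Bb] [c Cc].
have BA : B `<=` A by rewrite ABC; apply: subsetUl.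
have CA : C `<=` A by rewrite ABC; apply: subsetUr.
have [||||| _ [_ [[x Bx <-] [y Cy pyx]]]] :=
    connected_closed_meet pAconn (B := p @` B) (C := p @` C).
- exact: image_closed BA.
- exact: image_closed CA.
- by rewrite ABC image_setU.
- by exists (p b); split; exists b => //; apply: BA.
- by exists (p c); split; exists c => //; apply: CA.
have [||| z [_ BCz]] := connected_closed_meet (fib x (BA x Bx)) Bcl Ccl.
- by rewrite -ABC; apply: subIsetl.
- by exists x; split=> //; split=> //; apply: BA.
- by exists y; split=> //; split=> //; apply: CA.
by exists z.
Qed.

(** * Directed intersections of compact sets *)

(** The sets [K i] are a base of a proper filter; a cluster point found in the compact [K i0] lies
    in every closed [K i]. *)
Lemma directed_bigcap_neq0 {T : topologicalType} {I : Type} (K : I -> set T) :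
  inhabited I ->
  (forall i, compact (K i)) -> (forall i, closed (K i)) ->
  (forall i, K i !=set0) ->
  (forall i j, exists k, K k `<=` K i `&` K j) -> \bigcap_i K i !=set0.
Proof.
move=> [i0] Kc Kcl K0 dirK.
have PF : ProperFilter (filter_from setT K).
  apply: filter_from_proper => //.
  apply: filter_from_filter; first by exists i0.
  by move=> i j _ _; have [k] := dirK i j; exists k.
have [|x [_ xcl]] := Kc i0 _ PF; first by exists i0.
exists x => i _; apply: Kcl; move: xcl; rewrite clusterE; apply.
by exists i.
Qed.

Lemma compact_disjoint_open {T : topologicalType} {A B : set T} :
  hausdorff_space T -> compact [set: T] -> closed A -> closed B ->
  A `&` B = set0 ->
  exists U V, [/\ open U, open V, A `<=` U, B `<=` V & U `&` V = set0].
Proof.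
move=> hT Tc Acl Bcl AB0.
have nB : set_nbhs A (~` B).
  by apply/set_nbhsP; exists (~` B); split=> //;
    [exact: closed_openC|exact/disjoints_subset].
have [C AC CB] := compact_normal hT Tc Acl nB.
have [U [oU AU UC]] := (set_nbhsP _ _).1 AC.
exists U, (~` closure C); split=> //.
- exact/closed_openC/closed_closure.
- by move=> x Bx Cx; have := CB x Cx.
- by apply/disjoints_subset => x /UC Cx; rewrite setCK; apply: subset_closure.
Qed.

Lemma directed_bigcap_connected {T : topologicalType} {I : Type}
    {K : I -> set T} :
  inhabited I -> hausdorff_space T -> compact [set: T] ->
  (forall i, closed (K i)) -> (forall i, connected (K i)) ->
  (forall i j, exists k, K k `<=` K i `&` K j) -> connected (\bigcap_i K i).
Proof.
move=> I0 hT Tc Kcl Kconn dirK.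
apply: closed_connected; first by apply: closed_bigI => i _; apply: Kcl.
move=> B C Bcl Ccl KBC [b Bb] [c Cc]; apply/set0P/negP => /eqP BC0.
have [U [V [oU oV BU CV UV0]]] := compact_disjoint_open hT Tc Bcl Ccl BC0.
have UV x : U x -> ~ V x.
  by move=> Ux Vx; have : (U `&` V) x by []; rewrite UV0.
have Kb i : K i b by have : (\bigcap_i K i) b by [rewrite KBC; left]; apply.
have Kc i : K i c by have : (\bigcap_i K i) c by [rewrite KBC; right]; apply.
have UVcl : closed (~` (U `|` V)) by apply/open_closedC/openU.
(* Otherwise the sets [K i] minus [U] and [V] are a directed family of nonempty compact sets; a
   common point would be in the intersection but in neither [B] nor [C]. *)
have [i KUV] : exists i, K i `<=` U `|` V.
  apply: contrapT => /forallNP KUV.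
  have [|i||i j|x xK] :=
      directed_bigcap_neq0 (fun i => K i `&` ~` (U `|` V)) I0.
  - by move=> i; apply: subclosed_compact Tc _ => //; apply: closedI.
  - exact: closedI.
  - move=> i; apply/set0P/negP => /eqP/disjoints_subset; rewrite setCK.
    exact: KUV.
  - by have [k kij] := dirK i j; exists k => x [/kij[]].
  - have : (\bigcap_i K i) x by move=> i _; case: (xK i Logic.I).
    case: I0 => i0; have [_ nUV] := xK i0 Logic.I.
    by rewrite KBC => -[/BU|/CV] ?; apply: nUV; [left|right].
(* Since [U] and [V] are disjoint, the closed complements of [V] and [U] cover [K i]; a shared point
   in [K i] would avoid both [U] and [V]. *)
have [||||| x [/KUV Kx [nVx nUx]]] :=
    connected_closed_meet (Kconn i) (B := ~` V) (C := ~` U).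
- exact: open_closedC.
- exact: open_closedC.
- by move=> x /KUV[/UV nVx|Vx]; [left|right=> /UV].
- by exists b; split=> // /(UV _ (BU b Bb)).
- by exists c; split=> // /UV; apply; apply: CV.
by case: Kx.
Qed.

(** * Powers of a connected space *)

(** The component of [x] is closed and contains all points differing from [x] in finitely many
    coordinates, which are dense. *)
Lemma prod_connected {I : eqType} {X : topologicalType} :
  connected [set: X] -> connected [set: prod_topology (fun _ : I => X)].
Proof.
move=> Xconn; have [[x _]|E] :=
  pselect ([set: prod_topology (fun _ : I => X)] !=set0); last first.
  rewrite (_ : setT = set0); first exact: connected0.
  by apply/seteqP; split=> // x; case: E; exists x.
  rewrite (_ : setT = connected_component setT x).
    exact: component_connected.
  apply/seteqP; split=> // y _.
  set C := connected_component _ _.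
  have Ccl : closed C by apply/component_closed/closedT.
  pose z (s : seq I) : prod_topology (fun _ : I => X) :=
    fun i => if i \in s then y i else x i.
  (* Along the filter of ever larger finite lists, each coordinate of [z s] is eventually that of
     [y]. *)
  pose F :=
    filter_from setT (fun s : seq I => [set t : seq I | {subset s <= t}]).
  have PF : ProperFilter F.
    apply: filter_from_proper; last by move=> s _; exists s.
    apply: filter_from_filter; first by exists [::].
    move=> s t _ _; exists (s ++ t) => // u stu.
    by split=> i ist; apply: stu; rewrite mem_cat ist ?orbT.
  have zy : z @ F --> y.
    apply/cvg_sup => i U [V] [[W oW <-] Wyi WU]; exists [:: i] => // t /= it.
    by apply: WU; rewrite /= /z it ?mem_head.
  have zC s : C (z s).
    elim: s => [|i s].
      rewrite (_ : z [::] = x); first exact: connected_component_refl.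
      exact/funext.
    move=> Cs; apply: connected_component_trans Cs _.
    (* Varying coordinate [i] alone traces a continuous image of the connected [X]. *)
    exists (dfwith (z s) i @` setT); first split=> //.
    + exists (z s i) => //; apply/funext => j.
      by case: dfwithP.
    + apply: connected_continuous_connected => //.
      exact/continuous_subspaceT/dfwith_continuous.
    + exists (y i) => //; apply/funext => j; rewrite /z inE.
      case: dfwithP => [|j' ij]; first by rewrite eqxx.
      by rewrite eq_sym (negbTE ij).
  by apply: (closed_cvg C Ccl _ _ zy); apply: nearW => s; apply: zC.
Qed.

(** * Closed graphs and Hausdorff products *)

(** Off the graph, disjoint open [U] and [V] separate [f x] from [y]; near [x] all values stay in
    [U] and so miss [V]. *)
Lemma usc_graph_closed {X Y : topologicalType} {f : X -> set Y} :
  hausdorff_space Y -> compact [set: Y] -> usc f ->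
  (forall x, compact (f x)) -> closed (graph f).
Proof.
move=> hY Yc fusc fc; rewrite -[graph f]setCK; apply: open_closedC.
rewrite openE => -[x y] /= nfxy.
have [||U [V [oU oV fU yV UV0]]] :=
    compact_disjoint_open hY Yc (compact_closed hY (fc x)) (B := [set y]).
- by apply: compact_closed => //; apply: compact_set1.
- by apply/disjoints_subset => z fxz /= zy; apply: nfxy; rewrite -zy.
have [W [oW Wx WU]] := fusc x U oU fU.
exists (W, V) => /=.
  by split; apply: open_nbhs_nbhs; split=> //; apply: yV.
move=> [u v] /= [/WU fuU Vv] /= /fuU Uv.
by have : (U `&` V) v by []; rewrite UV0.
Qed.

Lemma hausdorff_prod {X Y : topologicalType} :
  hausdorff_space X -> hausdorff_space Y -> hausdorff_space (X * Y)%type.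
Proof.
move=> hX hY [a b] [c d] cl; congr pair; [apply: hX|apply: hY] => A B nA nB.
  have [||[x y] [/= [Ax _] [Bx _]]] := cl (A `*` setT) (B `*` setT).
  - by exists (A, setT) => //; split=> //; apply: filterT.
  - by exists (B, setT) => //; split=> //; apply: filterT.
  - by exists x.
have [||[x y] [/= [_ Ay] [_ By]]] := cl (setT `*` A) (setT `*` B).
- by exists (setT, A) => //; split=> //; apply: filterT.
- by exists (setT, B) => //; split=> //; apply: filterT.
- by exists y.
Qed.

(** * Limits over finitely many indices *)

(** Coordinates outside [s] are kept but left free, so all these sets live in one compact space and
    can be intersected directly. *)
Definition partial_limit {disp : Order.disp_t} {D : orderType disp}
    {X : topologicalType} (f : X -> set X) (s : seq D) :
    set (prod_topology (fun _ : D => X)) :=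
  [set x | forall a b, a \in s -> b \in s -> (a < b)%O -> f (x b) (x a)].

Lemma pair_continuous {S T U : topologicalType} {g : S -> T} {h : S -> U} :
  continuous g -> continuous h -> continuous (fun x => (g x, h x)).
Proof. by move=> gc hc x; apply: cvg_pair; [exact: gc|exact: hc]. Qed.

Lemma coord_continuous {D : eqType} {X : topologicalType} (a : D) :
  continuous (fun x : prod_topology (fun _ : D => X) => x a).
Proof. exact: (@proj_continuous D (fun=> X) a). Qed.

Lemma coord_pair_continuous {D : eqType} {X : topologicalType} (a b : D) :
  continuous (fun x : prod_topology (fun _ : D => X) => (x b, x a)).
Proof. by apply: pair_continuous; exact: coord_continuous. Qed.

Lemma to_prod_continuous {S X : topologicalType} {D : eqType}
    {h : S -> prod_topology (fun _ : D => X)} :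
  (forall i, continuous (fun x => h x i)) -> continuous h.
Proof.
move=> hc x; apply/cvg_sup => i U [V] [[W oW <-] Wxi WU].
apply: filterS WU _; apply: (hc i x).
exact: open_nbhs_nbhs.
Qed.

Lemma preimage_coord_pair_closed {D : eqType} {X : topologicalType} (a b : D)
    {f : X -> set X} :
  closed (graph f) ->
  closed [set x : prod_topology (fun _ : D => X) | f (x b) (x a)].
Proof.
have /continuous_closedP edge_cl := @coord_pair_continuous D X a b.
exact: edge_cl.
Qed.

Lemma partial_limit_closed {disp : Order.disp_t} {D : orderType disp}
    {X : topologicalType} {f : X -> set X} (s : seq D) :
  closed (graph f) -> closed (partial_limit f s).
Proof.
move=> fcl.
rewrite (_ : partial_limit f s =
  \bigcap_(p in [set p : D * D | [/\ p.1 \in s, p.2 \in s & (p.1 < p.2)%O]])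
    [set x | f (x p.2) (x p.1)]).
  by apply: closed_bigI => p _; apply: preimage_coord_pair_closed.
apply/seteqP; split=> x xs; first by move=> [a b] [/= sa sb ab]; apply: xs.
by move=> a b sa sb ab; apply: (xs (a, b)).
Qed.

Lemma sub_partial_limit {disp : Order.disp_t} {D : orderType disp}
    {X : topologicalType} {f : X -> set X} {s t : seq D} :
  {subset s <= t} -> partial_limit f t `<=` partial_limit f s.
Proof. by move=> st x xt a b /st ta /st tb; apply: xt. Qed.

(** For an index [d] after [b], idempotency with [x b] as intermediate value turns the conditions
    for [b], [d] and [a], [b] into the one for [a], [d]. *)
Lemma partial_limit_cons {disp : Order.disp_t} {D : orderType disp}
    {X : topologicalType} {f : X -> set X} {a b : D} {s : seq D} :
  mv_idempotent f -> path <%O a (b :: s) ->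
  partial_limit f (a :: b :: s) =
  partial_limit f (b :: s) `&` [set x | f (x b) (x a)].
Proof.
move=> fid /[dup] asorted /= /andP[ab bs]; apply/seteqP; split=> x.
  move=> xabs; split.
    apply: sub_partial_limit xabs => c.
    by rewrite [_ \in a :: _]in_cons => ->; rewrite orbT.
  by apply: xabs => //; rewrite !inE eqxx ?orbT.
move=> [xbs /= fba].
have /allP ltas := order_path_min lt_trans asorted.
have /allP ltbs := order_path_min lt_trans bs.
move=> c d; rewrite ![_ \in a :: _]in_cons.
move=> /orP[/eqP->|cbs] /orP[/eqP->|dbs] cd.
- by rewrite ltxx in cd.
- move: (dbs); rewrite inE => /orP[/eqP->//|ds].
  rewrite -fid; exists (x b); split=> //; apply: xbs => //; last exact: ltbs.
  exact: mem_head.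
- by have := lt_trans cd (ltas c cbs); rewrite ltxx.
- exact: xbs.
Qed.

Lemma partial_limit1 {disp : Order.disp_t} {D : orderType disp}
    {X : topologicalType} {f : X -> set X} {a : D} :
  partial_limit f [:: a] = setT.
Proof.
apply/seteqP; split=> // x _ b c; rewrite !inE => /eqP-> /eqP->.
by rewrite ltxx.
Qed.

Lemma partial_limit_dfwith {disp : Order.disp_t} {D : orderType disp}
    {X : topologicalType} {f : X -> set X} {s : seq D} {a : D} {t : X}
    {x : prod_topology (fun _ : D => X)} :
  a \notin s -> partial_limit f s x -> partial_limit f s (dfwith x a t).
Proof.
move=> sa xs b c sb sc bc.
by rewrite !dfwithout; [exact: xs|apply: contraNneq sa => ->..].
Qed.

(** Surjectivity gives [q] with [p] in [f q]; a point with value [q] at [b] exists by induction, and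
    its free coordinate [a] is overwritten by [p]. *)
Lemma partial_limit_coord_surj {disp : Order.disp_t} {D : orderType disp}
    {X : topologicalType} {f : X -> set X} {a : D} {s : seq D} (p : X) :
  mv_idempotent f -> mv_surjective f -> path <%O a s ->
  exists2 x, partial_limit f (a :: s) x & x a = p.
Proof.
move=> fid fsurj; elim: s a p => [|b s IHs] a p.
  by move=> _; exists (fun=> p) => //; rewrite partial_limit1.
move=> /[dup] asorted /andP[ab bs].
have [q fqp] := fsurj p; have [x xbs xbq] := IHs b q bs.
have nabs : a \notin b :: s.
  by apply/negP => /(allP (order_path_min lt_trans asorted)); rewrite ltxx.
exists (dfwith x a p); last by rewrite dfwithin.
rewrite partial_limit_cons//; split; first exact: partial_limit_dfwith.
rewrite /= dfwithin dfwithout ?xbq//.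
by apply: contraTneq ab => ->; rewrite ltxx.
Qed.

(** * Adding one bonding condition *)

Section one_bonding_step.
Context {D : eqType} {X : topologicalType}.
Context (hX : hausdorff_space X) (Xc : compact [set: X]).
Notation P := (prod_topology (fun _ : D => X)).
(** [G] stands for a partial limit in which coordinate [a] is still free, as [Ga] expresses. *)
Context {G : set P} {a b : D} (ab : a != b).
Context (Gcl : closed G) (Gconn : connected G).
Context (Ga : forall x t, G x -> G (dfwith x a t)).

Lemma prod_compact : compact [set: P].
Proof.
have := @tychonoff D (fun=> X) (fun=> setT) (fun=> Xc).
by rewrite (_ : [set _ | _] = setT)//; apply/seteqP; split.
Qed.

Lemma prod_hausdorff : hausdorff_space P.
Proof. exact: (@hausdorff_product D (fun=> X)). Qed.

Lemma connected_step_subcontinua {g : X -> set X} :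
  usc g -> (forall x, subcontinua (g x)) ->
  connected (G `&` [set x | g (x b) (x a)]).
Proof.
move=> gusc gsub.
have gcl : closed (graph g).
  by apply: usc_graph_closed => // x; have [[]] := gsub x.
have Kcl : closed (G `&` [set x | g (x b) (x a)]).
  by apply: closedI => //; apply: preimage_coord_pair_closed.
have [->|/set0P[x0 _]] := eqVneq (G `&` [set x | g (x b) (x a)]) set0.
  exact: connected0.
(* Resetting coordinate [a] to a constant plays the role of projecting it away. *)
pose forget (x : P) : P := dfwith x a (x0 a).
have forget_cont : continuous forget.
  apply: to_prod_continuous => i; have [<-|ai] := eqVneq a i.
    rewrite (_ : (fun x => _) = fun=> x0 a); first exact: cst_continuous.
    by apply/funext => x; rewrite /forget dfwithin.
  rewrite (_ : (fun x => _) = fun x => x i); first exact: coord_continuous.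
  by apply/funext => x; rewrite /forget dfwithout.
have gbN x t : dfwith x a t b = x b by rewrite dfwithout.
apply: (connected_fibers (p := forget)) => //.
- exact: prod_hausdorff.
- exact: prod_hausdorff.
- exact: subclosed_compact prod_compact _.
(* No point of the image is lost: values of [g] are nonempty, so coordinate [a] can be refilled. *)
- rewrite (_ : _ @` _ = forget @` G).
    by apply: connected_continuous_connected => //; apply: continuous_subspaceT.
  apply/seteqP; split; first by apply: image_subset; exact: subIsetl.
  move=> _ [x Gx <-]; have [[[t gt] _] _] := gsub (x b).
  exists (dfwith x a t).
    by split; [exact: Ga|rewrite /= dfwithin gbN].
  by apply/funext => i; rewrite /forget; case: dfwithP => [|j aj];
    rewrite ?dfwithin// !dfwithout.
(* The fiber through [x] is a copy of the connected set [g (x b)] in direction [a]. *)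
- move=> x [Gx _]; rewrite (_ : _ `&` _ = dfwith x a @` g (x b)).
    apply: connected_continuous_connected; first by have [] := gsub (x b).
    exact/continuous_subspaceT/dfwith_continuous.
  apply/seteqP; split=> y.
    move=> [[Gy gy] /= yx].
    have yxi i : a != i -> y i = x i.
      by move=> ai; have := congr1 (@^~ i) yx; rewrite /forget !dfwithout.
    exists (y a); first by rewrite -(yxi b ab).
    by apply/funext => i; case: dfwithP => // j /yxi.
  move=> [t gt <-]; split; first by split; [exact: Ga|rewrite /= dfwithin gbN].
  by apply/funext => i; rewrite /forget; case: dfwithP => [|j aj];
    rewrite ?dfwithin// !dfwithout.
Qed.

Lemma connected_step {f : X -> set X} {F : set (X -> set X)} :
  (forall p, exists2 x, G x & x b = p) -> closed (graph f) ->
  connected (graph f) ->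
  (forall g, F g -> usc g /\ forall x, subcontinua (g x)) ->
  graph f = \bigcup_(g in F) graph g ->
  connected (G `&` [set x | f (x b) (x a)]).
Proof.
move=> Gb fcl fconn Fsub fF.
set K := G `&` _.
have Kcl : closed K.
  by apply: closedI => //; apply: preimage_coord_pair_closed.
have Kc : compact K by exact: subclosed_compact prod_compact _.
have sliceK g : F g -> G `&` [set x | g (x b) (x a)] `<=` K.
  move=> Fg x [Gx gx]; split=> //.
  by have : graph f (x b, x a) by rewrite fF; exists g.
apply: closed_connected => // B C Bcl Ccl KBC [u Bu] [v Cv].
have BK : B `<=` K by rewrite KBC; apply: subsetUl.
have CK : C `<=` K by rewrite KBC; apply: subsetUr.
pose edge (x : P) : X * X := (x b, x a).
have edge_cont : continuous edge := @coord_pair_continuous D X a b.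
have [||||| e [fe [[x Bx xe] [y Cy ye]]]] :=
    connected_closed_meet fconn (B := edge @` B) (C := edge @` C).
- by apply: image_closed BK => //; exact: hausdorff_prod.
- by apply: image_closed CK => //; exact: hausdorff_prod.
(* Every graph point is an edge of [K]: take a point of [G] over [p] and set its coordinate [a] to
   [t]. *)
- move=> [p t] /= fpt; have [x Gx xb] := Gb p.
  suff : (edge @` K) (p, t) by rewrite KBC image_setU.
  exists (dfwith x a t).
    by split; [exact: Ga|rewrite /= dfwithin dfwithout// xb].
  by rewrite /edge dfwithin dfwithout// xb.
- by exists (edge u); split; [have [] := BK u Bu|exists u].
- by exists (edge v); split; [have [] := CK v Cv|exists v].
(* The common edge lies on the graph of a single [g], so [x] and [y] both lie in the connected slice
   of [K] given by [g]. *)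
move: fe; rewrite fF => -[g Fg ge].
have gx : graph g (edge x) by rewrite xe.
have gy : graph g (edge y) by rewrite ye.
have [gusc gsub] := Fsub g Fg.
have [||| z [_ BCz]] :=
    connected_closed_meet (connected_step_subcontinua gusc gsub) Bcl Ccl.
- by rewrite -KBC; exact: sliceK.
- by exists x; split=> //; split=> //; have [] := BK x Bx.
- by exists y; split=> //; split=> //; have [] := CK y Cy.
by exists z.
Qed.

End one_bonding_step.

(** * Passage to the inverse limit *)

Theorem theorem5p8 (R : realType) (X : metricType R) (f : X -> set X)
    (disp : Order.disp_t) (D : orderType disp)
    (X_continuum : metric_continuum X)
    (f_hyperspace : forall x : X, hyperspace (f x))
    (f_idempotent : mv_idempotent f)
    (f_surjective : mv_surjective f)
    (f_usc : usc f)
    (f_graph_connected : connected (graph f))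
    (f_graph_union : exists G : set (X -> set X),
        (forall g : X -> set X, G g ->
           usc g /\ forall x : X, subcontinua (g x)) /\
        graph f = \bigcup_(g in G) graph g) :
  hausdorff_continuum (@single_inverse_limit disp D X f).
Proof.
have [hX [x0 _] Xc Xconn] := X_continuum.
have [F [Fsub fF]] := f_graph_union.
have fcl : closed (graph f).
  by apply: usc_graph_closed => // x; have [] := f_hyperspace x.
have limE : single_inverse_limit f = \bigcap_s @partial_limit _ D _ f s.
  apply/seteqP; split=> x.
    move=> xlim s _ a b _ _ ab.
    by have := xlim a b (ltW ab); rewrite /single_bonding ab.
  move=> xlim a b; rewrite le_eqVlt /single_bonding => /orP[/eqP->|ab].
    by rewrite ltxx.
  (* Each bonding condition is already seen by a two-element list. *)
  by rewrite ab; apply: (xlim [:: a; b]) => //; rewrite !inE eqxx ?orbT.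
(* Only membership in [s] matters, so [s] may be taken strictly increasing, as the induction
   needs. *)
have partial_sort (s : seq D) :
    partial_limit f s = partial_limit f (sort <=%O (undup s)).
  apply/seteqP; split; apply: sub_partial_limit => a;
    by rewrite mem_sort mem_undup.
have sorted_conn a (s : seq D) :
    path <%O a s -> connected (partial_limit f (a :: s)).
  elim: s a => [|b s IHs] a.
    by move=> _; rewrite partial_limit1; exact: prod_connected.
  move=> /[dup] asorted /andP[ab bs].
  have nabs : a \notin b :: s.
    by apply/negP => /(allP (order_path_min lt_trans asorted)); rewrite ltxx.
  rewrite partial_limit_cons//.
  apply: (connected_step _ _ _ _ _ _ _ fcl f_graph_connected Fsub fF) => //.
  - by apply: contraTneq ab => ->; rewrite ltxx.
  - exact: partial_limit_closed.
  - exact: IHs.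
  - by move=> x t; exact: partial_limit_dfwith.
  - by move=> p; exact: partial_limit_coord_surj.
have partial_conn s : connected (@partial_limit _ D _ f s).
  rewrite partial_sort; have : sorted <%O (sort <=%O (undup s)).
    by rewrite sort_lt_sorted undup_uniq.
  case: (sort _ _) => [_|a t]; last exact: sorted_conn.
  rewrite (_ : partial_limit f [::] = setT); first exact: prod_connected.
  by apply/seteqP; split.
have partial_neq0 s : @partial_limit _ D _ f s !=set0.
  rewrite partial_sort; have : sorted <%O (sort <=%O (undup s)).
    by rewrite sort_lt_sorted undup_uniq.
  case: (sort _ _) => [_|a t /= at_]; first by exists (fun=> x0).
  have [x xat _] := partial_limit_coord_surj x0 f_idempotent f_surjective at_.
  by exists x.
have dir s t : exists u,
    @partial_limit _ D _ f u `<=` partial_limit f s `&` partial_limit f t.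
  by exists (s ++ t) => x xst; split; apply: sub_partial_limit xst => a ast;
    rewrite mem_cat ast ?orbT.
have partial_cl s := @partial_limit_closed _ D _ f s fcl.
have partial_c s : compact (@partial_limit _ D _ f s).
  exact: subclosed_compact (prod_compact Xc) _.
split; rewrite ?limE.
- exact: prod_hausdorff.
- exact: directed_bigcap_neq0 (inhabits [::]) _ _ _ _.
- apply: subclosed_compact (prod_compact Xc) _ => //.
  by apply: closed_bigI => s _.
- apply: (directed_bigcap_connected (inhabits [::])) => //.
    exact: prod_hausdorff.
  exact: prod_compact.
Qed.
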